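(* It is decidable whether a finitely based avoidance set of double ascents under the consecutive order is well quasi-ordered; that is, there is an algorithm which, given a finite set $B$ of double ascents, decides whether the avoidance set $\mathrm{Av}(B)$ of the poset $\mathcal{DA}$ of double ascents under the consecutive order is well quasi-ordered.
   Context: A permutation of length $n\ge1$ is a sequence $\sigma=\sigma_1\dots\sigma_n$ containing each of $1,\dots,n$ exactly once. An adjacent inversion of $\sigma$ is a pair $(\sigma_i,\sigma_{i+1})$ of consecutive entries with $\sigma_{i+1}<\sigma_i$. A double ascent is a permutation with at most one adjacent inversion. Two sequences of distinct numbers are isomorphic ($\cong$) if replacing in each the smallest number by 1, the second smallest by 2, and so on, gives the same permutation. For a set $X$ of numbers, $\tau\upharpoonright_X$ is the subsequence of $\tau$ consisting of the entries whose values lie in $X$. Consecutive order (with respect to values): for permutations $\sigma$ of length $n$ and $\rho$ of length $m$, $\sigma\leq\rho$ iff $\sigma\cong\rho\upharpoonright_{[k,k+n-1]}$ for some $k\ge1$ with $k+n-1\le m$, where $[k,l]=\{k,k+1,\dots,l\}$. $\mathcal{DA}$ is the set of double ascents with this order. $\mathrm{Av}(B)=\{\rho\in\mathcal{DA}:\sigma\nleq\rho\text{ for all }\sigma\in B\}$. A poset is well quasi-ordered if it has neither infinite antichains nor infinite descending sequences. *)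

(* Defs.v *)
From mathcomp Require Import all_boot.

Set Implicit Arguments.
Unset Strict Implicit.
Unset Printing Implicit Defensive.

Definition is_perm (s : seq nat) : bool :=
  (0 < size s) && perm_eq s (iota 1 (size s)).

Definition adjacent_inversions (s : seq nat) : nat :=
  count (fun i => nth 0 s i.+1 < nth 0 s i) (iota 0 (size s).-1).

Definition double_ascent (s : seq nat) : bool :=
  is_perm s && (adjacent_inversions s <= 1).

(* For a sequence of distinct numbers, the smallest entry is replaced by 1,
   the second smallest by 2, and so on. *)
Definition standardize (s : seq nat) : seq nat :=
  [seq (count (fun y => y < x) s).+1 | x <- s].

Definition isomorphic (s t : seq nat) : Prop := standardize s = standardize t.

Definition restrict (t : seq nat) (k l : nat) : seq nat :=
  [seq x <- t | k <= x <= l].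

(* The condition [1 <= k] makes the truncated subtraction exact. *)
Definition consecutive_le (s r : seq nat) : Prop :=
  exists k, [/\ 1 <= k, k + size s - 1 <= size r
              & isomorphic s (restrict r k (k + size s - 1))].

Definition Av (B : seq (seq nat)) (r : seq nat) : Prop :=
  double_ascent r /\ forall s, s \in B -> ~ consecutive_le s r.

Section WQO.
Variables (T : eqType) (le : T -> T -> Prop).

Definition infinite (A : T -> Prop) : Prop :=
  ~ exists s : seq T, forall x, A x -> x \in s.

Definition antichain (A : T -> Prop) : Prop :=
  forall x y, A x -> A y -> x <> y -> ~ le x y.

Definition infinite_descending (f : nat -> T) : Prop :=
  forall i, le (f i.+1) (f i) /\ f i.+1 <> f i.

Definition wqo (P : T -> Prop) : Prop :=
  ~ (exists A : T -> Prop,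
       [/\ forall x, A x -> P x, infinite A & antichain A]) /\
  ~ (exists f : nat -> T, (forall i, P (f i)) /\ infinite_descending f).

End WQO.

(* Partial recursive functions. Programs act on finite lists of arguments;
   absent arguments count as 0, so that no arities need be tracked. *)
Inductive program : Type :=
| Zero
| Succ
| Proj of nat
| Comp of program & seq program
| PrimRec of program & program
| Mu of program.

Inductive eval : program -> seq nat -> nat -> Prop :=
| eval_Zero xs : eval Zero xs 0
| eval_Succ xs : eval Succ xs (nth 0 xs 0).+1
| eval_Proj i xs : eval (Proj i) xs (nth 0 xs i)
| eval_Comp f gs xs ys y :
    size ys = size gs ->
    (forall i, i < size gs -> eval (nth Zero gs i) xs (nth 0 ys i)) ->
    eval f ys y ->
    eval (Comp f gs) xs y
| eval_PrimRec0 f g xs y :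
    eval f xs y -> eval (PrimRec f g) (0 :: xs) y
| eval_PrimRecS f g n xs z y :
    eval (PrimRec f g) (n :: xs) z -> eval g [:: n, z & xs] y ->
    eval (PrimRec f g) (n.+1 :: xs) y
| eval_Mu f xs n (v : nat -> nat) :
    (forall i, i < n -> eval f (i :: xs) (v i).+1) ->
    eval f (n :: xs) 0 ->
    eval (Mu f) xs n.

Lemma eval_functional p xs y z : eval p xs y -> eval p xs z -> y = z.
Proof.
move=> ev; elim: ev z => {p xs y}.
- by move=> xs z ev; inversion ev.
- by move=> xs z ev; inversion ev.
- by move=> i xs z ev; inversion ev.
- move=> f gs xs ys y szy _ IHg _ IHf z ev.
  inversion ev as [| | |f' gs' xs' ys' z' szy' evg evf| | |]; subst.
  apply: IHf; suff -> : ys = ys' by [].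
  apply: (@eq_from_nth _ 0); first by rewrite szy szy'.
  by move=> i; rewrite szy => lti; apply: IHg => //; apply: evg.
- by move=> f g xs y _ IH z ev; inversion ev; subst; apply: IH.
- move=> f g n xs w y _ IHw _ IHy z ev.
  inversion ev as [| | | | |f' g' n' xs' w' z' evw evy|]; subst.
  by apply: IHy; rewrite (IHw _ evw).
- move=> f xs n v _ IHv _ IH0 z ev.
  inversion ev as [| | | | | |f' xs' n' v' evv ev0]; subst.
  case: (ltngtP n z) => // [lt_nz | lt_zn].
    by have := IH0 _ (evv _ lt_nz).
  by have := IHv _ lt_zn _ ev0.
Qed.

(* Some program, run on the code of any [x] in the domain [D], halts with
   output 1 if [P x] holds and 0 otherwise. *)
Definition algorithmically_decidable (X : Type) (code : X -> nat)
    (D P : X -> Prop) : Prop :=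
  exists p : program, forall x, D x ->
    exists b : bool, eval p [:: code x] b /\ (b <-> P x).

(* [CodeSeq.code] is an effective bijection from [seq nat] to [nat]. *)
Definition code_basis (B : seq (seq nat)) : nat :=
  CodeSeq.code [seq CodeSeq.code s | s <- B].

(* Main.v *)
Require Import Defs.
From mathcomp Require Import all_boot zify.
From Stdlib Require Import Classical.

Set Implicit Arguments.
Unset Strict Implicit.
Unset Printing Implicit Defensive.

(** A double ascent consists of two increasing lines written one after the
    other, so it is determined by the word that tells, for each value, on
    which line it lies. Restricting a double ascent to an interval of values
    restricts its word to a factor. Only the identity permutations come from
    several words, and those words contain no letter of the second line
    followed by one of the first; so containment of double ascents is
    essentially the factor order on binary words, and membership in [Av B] is
    decided by the factors of length at most [N], where [N] bounds the lengths
    of the permutations in [B].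

    A flipped word is a word with a period [q] whose first and last letters
    have then been changed. Two long flipped words with the same pattern and
    different lengths are never factors of each other, because the changed
    letters would have to sit inside a periodic stretch
    ([flipped_not_factor]). Adding or removing whole periods does not change
    the short factors of a long flipped word ([flipped_pump]). Hence one
    flipped word of length at least [N + q + 2] that avoids [B] produces an
    infinite antichain ([flipped_not_wqo]).

    Conversely, let no flipped word with [q <= 2 ^ N] and length at least
    [N + q + 2] avoid [B], and let [u] be a word that does. Among any [2 ^ N + 1] consecutive windows of length
    [N] in [u] two coincide, which makes a stretch of [u] periodic. If the
    period broke down on both sides of the stretch, the two breaks would
    delimit a flipped factor of [u]; so the period persists up to one of the
    ends of [u] ([repeat_extends]). Therefore [u] is a periodic prefix, a
    middle of bounded length and a periodic suffix ([periodic_outside]). Up to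
    finitely many choices [u] is given by the lengths of the prefix and of the
    suffix, and it is a factor of any word of the same kind in which both
    lengths are at least as large. An antichain in a grid of pairs of numbers is finite,
    so [Av B] has no infinite antichain ([no_flipped_wqo]). Infinite
    descending sequences never exist, since lengths decrease.

    The algorithm searches for a flipped word that avoids [B]. Periods are
    bounded by [2 ^ N], lengths matter only modulo the period, and the code of
    [B] itself serves as [N], so the search is a primitive recursive
    predicate of that code ([flip_existsP]). *)

(** * Double ascents as binary words *)

(** The letter [u x] is [true] when the value [x] lies on the second line;
    [before u] is then the order in which the values are written. *)
Definition before (u : nat -> bool) (x y : nat) : bool :=
  if u x == u y then x <= y else u y.

Definition arrange (n : nat) (u : nat -> bool) : seq nat :=
  sort (before u) (iota 1 n).

(** Sortedness, rather than equality with [arrange], spares the algorithm any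
    computation of a permutation: it only compares neighbouring entries. *)
Definition occurs (s : seq nat) (n : nat) (u : nat -> bool) : Prop :=
  exists2 o, o + size s <= n & sorted (before (fun x => u (o + x))) s.

Lemma before_trans u : transitive (before u).
Proof.
move=> y x z; rewrite /before.
by case: (u x) (u y) (u z) => [] [] [] //=; lia.
Qed.

Lemma before_anti u : antisymmetric (before u).
Proof. by move=> x y; rewrite /before; case: (u x) (u y) => [] [] //=; lia. Qed.

Lemma before_total u : total (before u).
Proof. by move=> x y; rewrite /before; case: (u x) (u y) => [] [] //=; lia. Qed.

Lemma perm_arrange n u : perm_eq (arrange n u) (iota 1 n).
Proof. by rewrite perm_sort. Qed.

Lemma size_arrange n u : size (arrange n u) = n.
Proof. by rewrite size_sort size_iota. Qed.

Lemma sorted_arrange n u : sorted (before u) (arrange n u).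
Proof. exact/sort_sorted/before_total. Qed.

(** [before u] is a total order, so a set of values has one sorted
    enumeration. *)
Lemma arrange_unique s n u :
  perm_eq s (iota 1 n) -> sorted (before u) s -> s = arrange n u.
Proof.
move=> perm_s sort_s.
apply: sorted_eq (@before_trans u) (@before_anti u) _ _ sort_s _ _.
  exact: sorted_arrange.
by rewrite (perm_trans perm_s) // perm_sym perm_arrange.
Qed.

Lemma eq_sorted_before s n u v :
    (forall x, 0 < x <= n -> u x = v x) -> all (fun x => 0 < x <= n) s ->
  sorted (before u) s = sorted (before v) s.
Proof.
move=> eq_uv; apply: eq_in_sorted => x y lt_x lt_y.
by rewrite /before !eq_uv.
Qed.

Lemma perm_iota_bounds s n : perm_eq s (iota 1 n) -> all (fun x => 0 < x <= n) s.
Proof. by move=> /perm_all->; apply/allP => x; rewrite mem_iota; lia. Qed.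

Lemma eq_arrange n u v :
  (forall x, 0 < x <= n -> u x = v x) -> arrange n u = arrange n v.
Proof.
move=> eq_uv; apply: arrange_unique; first exact: perm_arrange.
rewrite -(eq_sorted_before eq_uv) ?sorted_arrange //.
exact/perm_iota_bounds/perm_arrange.
Qed.

Lemma is_perm_arrange n u : 0 < n -> is_perm (arrange n u).
Proof. by move=> n0; rewrite /is_perm size_arrange n0 perm_arrange. Qed.

Lemma count_lt_iota k n x :
  k <= x <= k + n -> count (fun y => y < x) (iota k n) = x - k.
Proof.
elim: n k => [|n IH] k le_x /=; first by lia.
case: ltnP => [lt_kx|le_xk]; first by rewrite IH; lia.
rewrite (@eq_in_count _ _ pred0) ?count_pred0; first by lia.
by move=> y; rewrite mem_iota /=; lia.
Qed.

(** In an interval of values, the rank of a value is its distance to the left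
    end. *)
Lemma standardize_interval s k n :
  perm_eq s (iota k n) -> standardize s = [seq (x - k).+1 | x <- s].
Proof.
move=> perm_s; apply/eq_in_map => x; rewrite (perm_mem perm_s) mem_iota => lt_x.
by rewrite (permP perm_s) count_lt_iota //; lia.
Qed.

Lemma standardize_perm s : is_perm s -> standardize s = s.
Proof.
case/andP=> _ perm_s; rewrite (standardize_interval perm_s).
rewrite -[RHS]map_id; apply/eq_in_map => x.
by rewrite (perm_mem perm_s) mem_iota; lia.
Qed.

Lemma perm_restrict t m k n : perm_eq t (iota 1 m) -> 0 < k -> 0 < n ->
  k + n - 1 <= m -> perm_eq (restrict t k (k + n - 1)) (iota k n).
Proof.
move=> perm_t k0 n0 le_m; apply: uniq_perm.
- by rewrite filter_uniq // (perm_uniq perm_t) iota_uniq.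
- exact: iota_uniq.
- by move=> x; rewrite mem_filter (perm_mem perm_t) !mem_iota; lia.
Qed.

(** The restriction is still sorted by [before u], and its values are
    consecutive, so standardizing it shifts them by [o]: the result is the
    arrangement of the factor of [u] that starts after [o]. *)
Lemma isomorphic_restrict s n u o : is_perm s -> o + size s <= n ->
  isomorphic s (restrict (arrange n u) o.+1 (o.+1 + size s - 1)) <->
  sorted (before (fun x => u (o + x))) s.
Proof.
move=> perm_s le_n; have /andP[s0 ps] := perm_s.
have pr : perm_eq (restrict (arrange n u) o.+1 (o.+1 + size s - 1)) (iota o.+1 (size s)).
  by apply: perm_restrict (perm_arrange n u) _ s0 _ => //; lia.
rewrite /isomorphic standardize_perm // (standardize_interval pr).
move: pr; set r := restrict _ _ _ => pr.
have sort_r : sorted (before u) r.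
  by rewrite /r /restrict; apply: sorted_filter (sorted_arrange n u); apply: before_trans.
have std_r : [seq (x - o.+1).+1 | x <- r] = arrange (size s) (fun x => u (o + x)).
  apply: arrange_unique.
    have -> : iota 1 (size s) = [seq (x - o.+1).+1 | x <- iota o.+1 (size s)].
      apply: (@eq_from_nth _ 0); rewrite ?size_map ?size_iota // => i lt_i.
      by rewrite (nth_map 0) ?size_iota // !nth_iota //; lia.
    exact: perm_map.
  rewrite sorted_map; apply: (sub_in_sorted (P := mem r)) sort_r; last exact: allss.
  move=> x y; rewrite !(perm_mem pr) !mem_iota => lt_x lt_y; rewrite /before /=.
  have -> : o + (x - o.+1).+1 = x by lia.
  have -> : o + (y - o.+1).+1 = y by lia.
  case: (u x == u y) => // le_xy.
  lia.
rewrite std_r; split=> [->|]; first exact: sorted_arrange.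
exact: arrange_unique.
Qed.

Lemma consecutive_le_arrange s n u :
  is_perm s -> consecutive_le s (arrange n u) <-> occurs s n u.
Proof.
move=> perm_s; split=> [[[|o] [// _ le_n iso]] | [o le_n sort_s]].
  rewrite size_arrange in le_n.
  have le_on : o + size s <= n by lia.
  by exists o => //; apply/(isomorphic_restrict u perm_s le_on).
exists o.+1; rewrite size_arrange; split=> //; first by lia.
by apply/(isomorphic_restrict u perm_s le_n).
Qed.

Lemma eq_occurs s n u v : is_perm s ->
  (forall x, 0 < x <= n -> u x = v x) -> occurs s n u -> occurs s n v.
Proof.
case/andP=> _ /perm_iota_bounds bs eq_uv [o le_n sort_s]; exists o => //.
rewrite -(@eq_sorted_before _ (size s) (fun x => u (o + x))) // => x lt_x.
by apply: eq_uv; lia.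
Qed.

Lemma occurs_factor s n n' u o :
  o + n' <= n -> occurs s n' (fun x => u (o + x)) -> occurs s n u.
Proof.
move=> le_n [i le_n' sort_s]; exists (o + i); first by lia.
suff -> : sorted (before (fun x => u (o + i + x))) s =
  sorted (before (fun x => u (o + (i + x)))) s by [].
by apply: eq_sorted => x y; rewrite /before !addnA.
Qed.

Lemma consecutive_le_factor n n' u o : 0 < n' -> o + n' <= n ->
  consecutive_le (arrange n' (fun x => u (o + x))) (arrange n u).
Proof.
move=> n0 le_n; apply/consecutive_le_arrange; first exact: is_perm_arrange.
by exists o; rewrite ?size_arrange ?sorted_arrange.
Qed.

Lemma adjacent_inversions_le1 s :
  (forall i j, i < j -> j.+1 < size s ->
    nth 0 s i.+1 < nth 0 s i -> nth 0 s j.+1 < nth 0 s j -> False) ->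
  adjacent_inversions s <= 1.
Proof.
rewrite /adjacent_inversions; set P := fun i => _ => H.
have {}H i j : i < j < (size s).-1 -> P i -> P j -> False.
  by move=> lt_ij Pi Pj; apply: (H i j) => //; lia.
have : forall m k, k + m <= (size s).-1 -> count P (iota k m) <= 1.
  elim=> // m IH k le_k /=; case Pk: (P k); last by apply: IH; lia.
  rewrite (@eq_in_count _ _ pred0) ?count_pred0 // => j; rewrite mem_iota => lt_j.
  by apply/negP => Pj; apply: (H k j) => //; lia.
by apply.
Qed.

(** Along [arrange n u] the letters change from [false] to [true] at most
    once, and the values increase as long as the letter is constant. *)
Lemma double_ascent_arrange n u : 0 < n -> double_ascent (arrange n u).
Proof.
move=> n0; rewrite /double_ascent is_perm_arrange //=.
apply: adjacent_inversions_le1 => i j lt_ij lt_j.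
have srt k l : k < l < size (arrange n u) ->
    before u (nth 0 (arrange n u) k) (nth 0 (arrange n u) l).
  move=> lt_kl; have sort_u := sorted_arrange n u.
  by apply: (sorted_ltn_nth (@before_trans u) 0 sort_u); rewrite ?inE; lia.
have := srt i i.+1; have := srt j j.+1.
have : before u (nth 0 (arrange n u) i.+1) (nth 0 (arrange n u) j).
  case: (ltnP i.+1 j) => [lt|ge]; first by apply: srt; lia.
  have -> : j = i.+1 by lia.
  by rewrite /before eqxx.
rewrite /before.
case: (u (nth 0 _ i)) (u (nth 0 _ i.+1)) (u (nth 0 _ j)) (u (nth 0 _ j.+1)).
all: by case=> [] [] [] //=; lia.
Qed.

(** The word puts on the second line the values that come after the first
    adjacent inversion. *)
Lemma double_ascentE s : double_ascent s -> exists u, s = arrange (size s) u.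
Proof.
case/andP=> /andP[s0 perm_s]; rewrite /adjacent_inversions.
set P := fun i => _; set I := iota _ _ => le1.
have [d dE] : {d | d = find P I} by exists (find P I).
exists (fun x => d < index x s).
apply: arrange_unique => //; apply/(sortedP 0) => i lt_i; have {}lt_i : i.+1 < size s := lt_i.
have us : uniq s by rewrite (perm_uniq perm_s) iota_uniq.
rewrite /before !index_uniq ?(ltnW lt_i) //.
have neq : nth 0 s i != nth 0 s i.+1 by rewrite nth_uniq ?(ltnW lt_i) //; lia.
case: (ltngtP i d) => [lt_id|lt_di|eq_id].
- have -> /= : (d < i.+1) = false by lia.
  rewrite leqNgt; apply/negP => Pi.
  have := @before_find _ 0 P I i; rewrite -dE lt_id => /(_ isT).
  by rewrite nth_iota /P ?Pi; lia.
- have -> /= : d < i.+1 by lia.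
  rewrite leqNgt; apply/negP => Pi.
  have hasP : has P I by rewrite has_find size_iota -dE; lia.
  have Pd := nth_find 0 hasP; rewrite -dE nth_iota in Pd; last by lia.
  have: size [:: d; i] <= size (filter P I).
    apply: uniq_leq_size => [|x]; first by rewrite /= inE; lia.
    by rewrite !inE mem_filter mem_iota => /orP[] /eqP->; rewrite ?Pd ?/P ?Pi /=; lia.
  by rewrite size_filter /=; lia.
- by rewrite eq_id; have -> : d < d.+1 by lia; rewrite ltnn.
Qed.

(** The positions in [arrange n u] recover [before u], hence the pairs of a
    letter [true] followed by a letter [false], which are the inversions of
    the permutation. *)
Lemma index_arrange n u x y : 0 < x <= n -> 0 < y <= n ->
  (index x (arrange n u) <= index y (arrange n u)) = before u x y.
Proof.
have mem_arr z : 0 < z <= n -> z \in arrange n u.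
  by move=> lt_z; rewrite (perm_mem (perm_arrange n u)) mem_iota; lia.
move=> lt_x lt_y; apply/idP/idP => [le_xy | bxy].
  have before_refl : reflexive (before u) by move=> z; rewrite /before eqxx.
  have sort_u := sorted_arrange n u.
  by apply: (sorted_leq_index (@before_trans u) _ sort_u); rewrite ?mem_arr.
rewrite leqNgt; apply/negP => lt_yx.
have byx : before u y x.
  have sort_u := sorted_arrange n u.
  by apply: (sorted_ltn_index (@before_trans u) sort_u); rewrite ?mem_arr.
by have eq_xy := @before_anti u x y; rewrite eq_xy ?bxy // ltnn in lt_yx.
Qed.

(** An inversion [i < j] of [u] pins down every letter: a value below [j] is
    on the second line iff it forms an inversion with [j], and a value above
    [i] is on the first line iff [i] forms an inversion with it. *)
Lemma arrange_inj n u v i j : arrange n u = arrange n v ->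
    0 < i -> i < j -> j <= n -> u i -> ~~ u j ->
  forall x, 0 < x <= n -> u x = v x.
Proof.
move=> eq_uv i0 lt_ij le_j ui uj.
have eqb x y : 0 < x <= n -> 0 < y <= n -> before u x y = before v x y.
  by move=> lt_x lt_y; rewrite -!(@index_arrange n) // eq_uv.
have inv x y : x < y -> 0 < x <= n -> 0 < y <= n -> (u x && ~~ u y) = (v x && ~~ v y).
  move=> lt_xy lt_x lt_y; have := eqb x y lt_x lt_y; rewrite /before.
  by case: (u x) (u y) (v x) (v y) => [] [] [] [] //=; lia.
have /andP[vi vj] : v i && ~~ v j by rewrite -inv ?ui ?uj //; lia.
move=> x lt_x; case: (ltngtP x i) => [lt_xi | lt_ix | ->]; last by rewrite ui vi.
  have := inv x j; rewrite (negPf uj) (negPf vj) !andbT.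
  by apply; lia.
by apply: negb_inj; have := inv i x lt_ix; rewrite ui vi; apply; lia.
Qed.

(** * Flipped words and infinite antichains *)

(** The letters are numbered from [1], as the values are, and residues from
    [0], whence the predecessor. *)
Definition flipped (c : nat -> bool) (q L x : nat) : bool :=
  c (x.-1 %% q) (+) ((x == 1) || (x == L)).

(** A factor of length at most [N] of a long flipped word meets at most one of
    the two ends. If it contains the first or the last letter, the other word
    has the same factor at the same end. Otherwise it lies in the periodic
    part, where only its position modulo [q] matters. *)
Lemma flipped_pump c q N L L' s :
    is_perm s -> size s <= N -> N + q + 2 <= L -> N + q + 2 <= L' ->
    L = L' %[mod q] -> 0 < q ->
  occurs s L (flipped c q L) -> occurs s L' (flipped c q L').
Proof.
move=> perm_s le_s leL leL' eqL q0 [o le_o sort_s].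
have /andP[s0 ps] := perm_s.
suff [o' le_o' eq_o] : exists2 o', o' + size s <= L' &
    forall x, 0 < x <= size s -> flipped c q L (o + x) = flipped c q L' (o' + x).
  exists o' => //.
  by rewrite -(eq_sorted_before eq_o) //; exact: perm_iota_bounds.
rewrite /flipped; case: (posnP o) => [-> | o0].
  exists 0; first by lia.
  move=> x lt_x; rewrite !add0n; have -> : (x == L) = false by lia.
  by have -> : (x == L') = false by lia.
case: (ltngtP (o + size s) L) => [lt | | eqo]; [| by lia |].
  (* The factor avoids both ends: it is moved to its first occurrence. *)
  exists (o.-1 %% q).+1; first by have := ltn_pmod o.-1 q0; lia.
  move=> x lt_x; have := ltn_pmod o.-1 q0 => lt_q.
  have -> : (o + x).-1 %% q = ((o.-1 %% q).+1 + x).-1 %% q.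
    have -> : (o + x).-1 = o.-1 + x by lia.
    by rewrite addSn /= modnDml.
  by congr (_ (+) _); lia.
(* The factor contains the last letter. *)
exists (L' - size s); first by lia.
move=> x lt_x; have -> : (o + x).-1 %% q = (L' - size s + x).-1 %% q.
  have -> : (L' - size s + x).-1 = L' - (size s - x).+1 by lia.
  have -> : (o + x).-1 = L - (size s - x).+1 by lia.
  apply/eqP; rewrite -(eqn_modDr (size s - x).+1) !subnK ?eqL //; lia.
by congr (_ (+) _); lia.
Qed.

Lemma flipped_interior c q L x : 1 < x < L -> flipped c q L x = c (x.-1 %% q).
Proof.
by move=> lt_x; rewrite /flipped (_ : _ || _ = false) ?addbF //; lia.
Qed.

Lemma flipped_first c q L : 0 < q -> q.+1 < L ->
  flipped c q L 1 = ~~ flipped c q L q.+1.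
Proof.
move=> q0 lt_q; rewrite (@flipped_interior _ _ _ q.+1) -?pred_Sn; last by lia.
by rewrite /flipped mod0n modnn addbT.
Qed.

Lemma flipped_last c q L : 0 < q -> q.+1 < L ->
  flipped c q L L = ~~ flipped c q L (L - q).
Proof.
move=> q0 lt_q; rewrite (@flipped_interior _ _ _ (L - q)); last by lia.
have eqL : L.-1 = (L - q).-1 + q by lia.
by rewrite /flipped eqL modnDr eqxx orbT addbT.
Qed.

(** Both end letters differ from the letter one period away. Either one of
    these two pairs is an inversion, or their inner letters form one. *)
Lemma flipped_inversion c q L : 0 < q -> 2 * q + 1 < L ->
  exists i j, [/\ 0 < i, i < j, j <= L, flipped c q L i & ~~ flipped c q L j].
Proof.
move=> q0 leL; have lt_q : q.+1 < L by lia.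
have := flipped_first c q0 lt_q; have := flipped_last c q0 lt_q.
case f1q: (flipped c q L q.+1) => fL f1; last first.
  by exists 1, q.+1; rewrite f1 f1q; split=> //; lia.
case e: (flipped c q L (L - q)) fL => /= fL.
  by exists (L - q), L; rewrite e fL; split=> //; lia.
by exists q.+1, (L - q); rewrite f1q e; split=> //; lia.
Qed.

(** If the shorter word starts after the first letter of the longer one, its
    first letter and the letter one period later both fall into the periodic
    part of the longer word, but they differ. If it starts at the first letter,
    it stops before the last one, and its last letter gives the same
    contradiction. *)
Lemma flipped_not_factor c q L L' o : 0 < q -> q + 2 <= L -> L < L' -> o + L <= L' ->
  ~ (forall x, 0 < x <= L -> flipped c q L x = flipped c q L' (o + x)).
Proof.
move=> q0 leL ltL le_o eq_f; have lt_q : q.+1 < L by lia.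
have per y : 1 < y -> y + q < L' -> flipped c q L' (y + q) = flipped c q L' y.
  move=> lt_y lt_yq; rewrite !flipped_interior; try lia.
  by rewrite (_ : (y + q).-1 = y.-1 + q) ?modnDr; lia.
have noteqb b : b = ~~ b -> False by case: b.
case: (posnP o) => [o0 | o0].
  have := flipped_last c q0 lt_q.
  have -> : flipped c q L L = flipped c q L (L - q); last exact: noteqb.
  have := per (L - q); rewrite eq_f; last by lia.
  rewrite (eq_f (L - q)); last by lia.
  rewrite o0 !add0n subnK; last by lia.
  by apply; lia.
have := flipped_first c q0 lt_q.
have -> : flipped c q L 1 = flipped c q L q.+1; last exact: noteqb.
rewrite (eq_f 1); last by lia.
rewrite (eq_f q.+1); last by lia.
have -> : o + q.+1 = o + 1 + q by lia.
by rewrite per; lia.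
Qed.

Definition avoids (B : seq (seq nat)) (n : nat) (u : nat -> bool) : Prop :=
  forall s, s \in B -> ~ occurs s n u.

Lemma Av_arrange B n u : all double_ascent B -> 0 < n ->
  Av B (arrange n u) <-> avoids B n u.
Proof.
move=> /allP daB n0; have pB s : s \in B -> is_perm s by case/daB/andP.
split=> [[_ av] s sB occ | av].
  by apply: (av s sB); apply/(consecutive_le_arrange n u (pB s sB)).
split=> [|s sB]; first exact: double_ascent_arrange.
by move/(consecutive_le_arrange n u (pB s sB)); apply: av.
Qed.

(** The antichain consists of the words of length [q * (N + 4 + k) + r]. The
    constant [4] makes even the shortest of them long enough both to be pumped
    ([N + q + 2]) and to have an inversion ([2 * q + 2]). *)
Lemma flipped_not_wqo B N q r c : all double_ascent B ->
    (forall s, s \in B -> size s <= N) -> r < q ->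
    avoids B (q * (N + 4) + r) (flipped c q (q * (N + 4) + r)) ->
  ~ wqo consecutive_le (Av B).
Proof.
move=> daB le_N lt_r avB [no_antichain _]; apply: no_antichain.
have q0 : 0 < q by lia.
pose L k := q * (N + 4 + k) + r.
have leL k : N + q + 2 <= L k /\ 2 * q + 1 < L k by rewrite /L; nia.
exists (fun s => exists k, s = arrange (L k) (flipped c q (L k))); split.
- move=> _ [k ->]; apply/Av_arrange => //; first by have := leL k; lia.
  move=> s sB occ; apply: (avB s sB).
  have := leL k; have := leL 0; rewrite {1 2}/L addn0 => [[l0 _] [lk _]].
  have /andP[perm_s _] := allP daB s sB.
  apply: (flipped_pump perm_s (le_N s sB) lk l0 _ q0 occ).
  by rewrite /L !(mulnC q) !modnMDl.
- move=> [l all_l].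
  have bound x : x \in l -> size x <= \sum_(y <- l) size y.
    by move=> xl; rewrite (big_rem x) //=; lia.
  set M := \sum_(y <- l) size y in bound.
  have := bound (arrange (L M) (flipped c q (L M))).
  rewrite size_arrange => H; have := H (all_l _ (ex_intro _ M erefl)).
  by rewrite /L; nia.
- move=> _ _ [k ->] [k' ->] neq.
  have leq_k := leL k; have leq_k' := leL k'.
  move=> /consecutive_le_arrange; case; first by apply: is_perm_arrange; lia.
  move=> o; rewrite size_arrange => le_o sort_s.
  have /arrange_inj inj := arrange_unique (perm_arrange _ _) sort_s.
  have [i [j [i0 ltij lej fi fj]]] := flipped_inversion c q0 (proj2 leq_k).
  case: (ltngtP (L k) (L k')) => [lt | lt | eqL]; [|lia|].
    apply: (@flipped_not_factor c q (L k) (L k') o); try lia.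
    exact: (inj i j).
  by apply: neq; rewrite eqL.
Qed.

(** * Words without flipped factors *)

(** The period is required of the letters in positions [a + 1] to [b], so that
    [periodic u q 0 n] is a period of a whole word of length [n]. *)
Definition periodic (u : nat -> bool) (q a b : nat) : Prop :=
  forall x, a < x -> x + q <= b -> u x = u (x + q).

Lemma periodic_iter u q a b x k :
  periodic u q a b -> a < x -> x + k * q <= b -> u x = u (x + k * q).
Proof.
move=> per lt_x; elim: k => [|k IH] le_b; first by rewrite mul0n addn0.
by rewrite mulSnr addnA -per ?IH //; lia.
Qed.

Lemma not_periodic u q a b : ~ periodic u q a b ->
  exists x, [&& a < x, x + q <= b & u x != u (x + q)].
Proof.
move=> nper; apply: NNPP => nex; apply: nper => x lt_x le_b.
by apply/eqP/negPn/negP => neq; apply: nex; exists x; rewrite lt_x le_b.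
Qed.

(** The two pairs [x, x + q] and [y, y + q] are consecutive breaks of the
    period, so the factor from [x] to [y + q] has period [q] once its end
    letters are changed. *)
Lemma flipped_between_breaks u q x y : 0 < q -> 0 < x -> x < y ->
    u x != u (x + q) -> u y != u (y + q) ->
    (forall t, x < t < y -> u t = u (t + q)) ->
  exists c, forall t, 0 < t <= y + q - x.-1 ->
    u (x.-1 + t) = flipped c q (y + q - x.-1) t.
Proof.
move=> q0 x0 ltxy neqx neqy eq_u; set L := y + q - x.-1.
(* The pattern is read off the first [q] letters; the very first one is the
   changed letter and has to be changed back. *)
pose c i := u (x + i) (+) (i == 0); exists c.
have per : periodic u q x (y + q).-1 by move=> t lt_t le_t; apply: eq_u; lia.
have interior t : x < t < y + q -> u t = c ((t - x) %% q).
  move=> lt_t; have := divn_eq (t - x) q; have := ltn_pmod (t - x) q0.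
  move: (_ %/ _) (_ %% _) => k r lt_r eq_t.
  case: (posnP r) => [r0 | r0].
    rewrite r0 /c eqxx addn0 addbT.
    have -> : ~~ u x = u (x + q) by case: (u x) (u (x + q)) neqx => [] [].
    case: k eq_t => [|k] eq_t; first by lia.
    have -> : t = x + q + k * q by lia.
    by rewrite -(periodic_iter per) //; lia.
  rewrite /c; have -> : t = x + r + k * q by lia.
  have -> : (r == 0) = false by lia.
  by rewrite addbF -(periodic_iter per) //; lia.
move=> t lt_t; rewrite /flipped.
case: (t =P 1) => [->|neq1].
  rewrite /= mod0n /c addbT eqxx addbT negbK addn0.
  by congr u; lia.
case: (t =P L) => [eq_t|neqL] /=; last first.
  rewrite addbF interior; last by lia.
  by congr (c (_ %% q)); lia.
have -> : x.-1 + t = y + q by lia.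
have -> : t.-1 = (y - x) + q by lia.
by rewrite modnDr addbT -interior; [case: (u y) (u (y + q)) neqy => [] [] | lia].
Qed.

(** The flipped factor lies between the last break of the period on the left
    of the periodic stretch and the first break on its right. *)
Lemma broken_period u q i e n :
    0 < q -> periodic u q i e -> e <= n -> q <= e - i ->
    ~ periodic u q 0 e -> ~ periodic u q i n ->
  exists o L c, [/\ o + L <= n, e - i + 2 <= L &
    forall x, 0 < x <= L -> u (o + x) = flipped c q L x].
Proof.
move=> q0 per le_n lt_q /not_periodic exl /not_periodic exr.
have bound x : [&& 0 < x, x + q <= e & u x != u (x + q)] -> x <= i.
  move=> /and3P[x0 le_x neq]; rewrite leqNgt; apply/negP => lt_ix.
  by rewrite (per x) ?eqxx in neq.
case: (ex_maxnP exl bound) => x /[dup] /bound lt_x /and3P[x0 le_x neqx] maxx.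
case: (ex_minnP exr) => y /and3P[lt_iy le_y neqy] miny.
have gt_y : e < y + q.
  by rewrite ltnNge; apply/negP => le_ye; rewrite per ?eqxx in neqy.
case: (@flipped_between_breaks u q x y) => //; first by lia.
  move=> t lt_t; apply/eqP/negPn/negP => neq.
  case: (leqP t i) => [le_ti | lt_it].
    by have := maxx t; rewrite neq; lia.
  by have := miny t; rewrite neq; lia.
by move=> c eq_c; exists x.-1, (y + q - x.-1), c; split=> //; lia.
Qed.

(** The left periodic part is indexed by the distance to the centre [ms], like
    the right one: enlarging [p] then shifts the word without changing its
    letters. *)
Definition biperiodic (ls ms rs : seq bool) (p x : nat) : bool :=
  if x <= p then nth false ls ((p - x) %% size ls)
  else if x <= p + size ms then nth false ms (x - p).-1
  else nth false rs ((x - (p + size ms)).-1 %% size rs).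

Definition bounded_perms (B : seq (seq nat)) (N : nat) : Prop :=
  forall s, s \in B -> is_perm s /\ size s <= N.

Definition no_flipped_word (B : seq (seq nat)) (N : nat) : Prop :=
  forall q r c, 0 < q <= 2 ^ N -> r < q ->
    ~ avoids B (q * (N + 4) + r) (flipped c q (q * (N + 4) + r)).

(** Pumping reduces any length to the representative [q * (N + 4) + r] of its
    residue modulo [q]. *)
Lemma flipped_excluded B N q L c :
    bounded_perms B N -> no_flipped_word B N ->
    0 < q <= 2 ^ N -> N + q + 2 <= L ->
  ~ avoids B L (flipped c q L).
Proof.
move=> permB noflip lt_q leL av; have q0 : 0 < q by lia.
apply: (noflip q _ c lt_q (ltn_pmod L q0)) => s sB occ; apply: (av s sB).
have [perm_s le_s] := permB s sB.
apply: (flipped_pump perm_s le_s _ leL _ q0 occ); first by nia.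
by rewrite mulnC modnMDl modn_mod.
Qed.

(** Two equal windows at distance [j - i] make a stretch of length
    [N + (j - i)] periodic; two breaks around it would delimit a flipped
    factor long enough to be excluded. *)
Lemma repeat_extends B N n u i j :
    bounded_perms B N -> no_flipped_word B N ->
    avoids B n u -> i < j -> j - i <= 2 ^ N ->
    j + N <= n -> (forall x, 0 < x <= N -> u (i + x) = u (j + x)) ->
  periodic u (j - i) 0 (j + N) \/ periodic u (j - i) i n.
Proof.
move=> permB noflip av lt_ij le_K le_n eq_u; apply: NNPP => /not_or_and[nper0 npern].
have per : periodic u (j - i) i (j + N).
  move=> x lt_x le_x; have := eq_u (x - i).
  have -> : i + (x - i) = x by lia.
  have -> : j + (x - i) = x + (j - i) by lia.
  by apply; lia.
have [||o [L [c [le_o leL eq_c]]]] := broken_period _ per le_n _ nper0 npern; try lia.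
apply: (@flipped_excluded B N (j - i) L c) => //; try lia.
move=> s sB occ; apply: (av s sB); apply: (occurs_factor le_o).
by apply: eq_occurs occ; [by case: (permB s sB) | move=> x lt_x; rewrite eq_c].
Qed.

(** There are only [2 ^ N] windows of length [N]. *)
Lemma window_repeat (u : nat -> bool) N t :
  exists i j, [/\ t <= i, i < j, j <= t + 2 ^ N &
  forall x, 0 < x <= N -> u (i + x) = u (j + x)].
Proof.
pose f (i : 'I_(2 ^ N).+1) := [ffun x : 'I_N => u (t + i + x.+1)].
have /injectivePn[i [j neq_ij eq_f]] : ~~ injectiveb f.
  apply/negP => /injectiveP /leq_card.
  by rewrite card_ord card_ffun card_bool card_ord ltnn.
wlog lt_ij : i j neq_ij eq_f / i < j.
  move=> wl; case: (ltngtP i j) => [|gt|/val_inj eq_ij]; first exact: wl.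
    by apply: (wl j i) => //; rewrite eq_sym.
  by rewrite eq_ij eqxx in neq_ij.
exists (t + i), (t + j); split; try by have := ltn_ord j; lia.
move=> x lt_x; have lt_xN : x.-1 < N by lia.
have /ffunP/(_ (Ordinal lt_xN)) := eq_f; rewrite !ffunE /= prednK //; lia.
Qed.

Lemma block_dichotomy B N n u t :
    bounded_perms B N -> no_flipped_word B N ->
    avoids B n u -> t + 2 ^ N + N <= n ->
  exists2 q, 0 < q <= 2 ^ N & periodic u q 0 t \/ periodic u q (t + 2 ^ N) n.
Proof.
move=> permB noflip av le_n.
have [i [j [le_ti lt_ij le_j eq_u]]] := window_repeat u N t.
exists (j - i); first by lia.
have [||per|per] := repeat_extends permB noflip av lt_ij _ _ eq_u; try lia.
  by left=> x lt_x le_x; apply: per; lia.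
by right=> x lt_x le_x; apply: per; lia.
Qed.

(** Each block of [2 ^ N + 1] consecutive positions yields a period of
    everything before it or of everything after it. Moving the block from left
    to right, the first case holds at the start; where it stops holding, the
    two periods are separated by about one block. *)
Lemma periodic_outside B N n u :
    bounded_perms B N -> no_flipped_word B N ->
    avoids B n u ->
  exists a b q q', [/\ a <= b <= n, b - a <= (2 ^ N + N).+1,
    0 < q <= 2 ^ N, 0 < q' <= 2 ^ N & periodic u q 0 a /\ periodic u q' b n].
Proof.
move=> permB noflip av.
have dichotomy t := block_dichotomy (t := t) permB noflip av.
have : 0 < 2 ^ N by rewrite expn_gt0.
move: (2 ^ N) dichotomy => K dichotomy K0.
have per_nil a : periodic u 1 a a by move=> x; lia.
case: (leqP n (K + N)) => [le_n | lt_n].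
  by exists 0, n, 1, 1; split=> //; try lia; split; apply: per_nil.
(* Either the prefix stays periodic up to position [t], or the switch occurred
   at an earlier position. *)
suff: forall t, t + K + N <= n ->
    (exists2 q, 0 < q <= K & periodic u q 0 t) \/
    exists a b q q', [/\ a <= b <= n, b - a <= (K + N).+1, 0 < q <= K,
      0 < q' <= K & periodic u q 0 a /\ periodic u q' b n].
  move=> /(_ (n - (K + N))); case; [by lia| |by []].
  move=> [q lt_q per]; exists (n - (K + N)), n, q, 1.
  by split=> //; try lia; split.
elim=> [|t IH] le_t; first by left; exists 1; [lia | exact: per_nil].
case: IH => [||]; [by lia | | by right].
move=> [q lt_q per]; have [q' lt_q' [perl|perr]] := dichotomy _ le_t.
  by left; exists q'.
by right; exists t, (t.+1 + K), q, q'; split=> //; lia.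
Qed.

Lemma avoids_biperiodic B N n u :
    bounded_perms B N -> no_flipped_word B N ->
    avoids B n u ->
  exists ls ms rs p k, [/\ size ls <= (2 ^ N + N).+1,
      size ms <= (2 ^ N + N).+1, size rs <= (2 ^ N + N).+1,
      n = p + size ms + k &
      forall x, 0 < x <= n -> u x = biperiodic ls ms rs p x].
Proof.
move=> permB noflip.
case/(periodic_outside permB noflip)=> a [b [q [q' [le_ab le_m lt_q lt_q' [perl perr]]]]].
exists (mkseq (fun i => u (a - i)) q), (mkseq (fun i => u (a + i.+1)) (b - a)).
exists (mkseq (fun i => u (b + i.+1)) q'), a, (n - b).
rewrite /biperiodic !size_mkseq; split; try lia.
move=> x lt_x; case: leqP => [le_xa | lt_ax].
  have := divn_eq (a - x) q; have lt_r : (a - x) %% q < q by rewrite ltn_pmod; lia.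
  rewrite nth_mkseq //; move: (_ %/ _) (_ %% _) lt_r => k r lt_r eq_x.
  by rewrite (@periodic_iter u q 0 a x k) //; [congr u | |]; lia.
case: leqP => [le_xb | lt_bx].
  by rewrite nth_mkseq; [congr u |]; lia.
have -> : (x - (a + (b - a))).-1 = x - b.+1 by lia.
have := divn_eq (x - b.+1) q'.
have lt_r : (x - b.+1) %% q' < q' by rewrite ltn_pmod; lia.
rewrite nth_mkseq //; move: (_ %/ _) (_ %% _) lt_r => k r lt_r eq_x.
have -> : x = b + r.+1 + k * q' by lia.
by rewrite -(periodic_iter perr) //; lia.
Qed.

(** * Finiteness of antichains *)
Definition finite (T : eqType) (A : T -> Prop) : Prop :=
  exists s : seq T, forall x, A x -> x \in s.

Lemma sub_finite (T : eqType) (A A' : T -> Prop) :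
  (forall x, A x -> A' x) -> finite A' -> finite A.
Proof. by move=> sub [s As]; exists s => x /sub/As. Qed.

Lemma finite_or (T : eqType) (A A' : T -> Prop) :
  finite A -> finite A' -> finite (fun x => A x \/ A' x).
Proof.
move=> [s As] [s' As']; exists (s ++ s') => x; rewrite mem_cat.
by case=> [/As-> | /As'->]; rewrite ?orbT.
Qed.

Lemma finite_exists (I T : eqType) (D : I -> Prop) (A : I -> T -> Prop) :
  finite D -> (forall i, D i -> finite (A i)) -> finite (fun x => exists2 i, D i & A i x).
Proof.
move=> [l Dl] finA.
suff [s As] : finite (fun x => exists2 i, i \in l & D i /\ A i x).
  by exists s => x [i Di Aix]; apply: As; exists i; [exact: Dl | split].
elim: l {Dl} => [|i l [s As]]; first by exists [::] => x [].
have [Di|nDi] := classic (D i); last first.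
  by exists s => x [j /predU1P[-> []//|lj] Aj]; apply: As; exists j.
have [s' As'] := finA i Di; exists (s' ++ s) => x [j /predU1P[->|lj] Aj].
  by rewrite mem_cat As' //; case: Aj.
by rewrite mem_cat As ?orbT //; exists j.
Qed.

Lemma finite_subsingleton (T : eqType) (A : T -> Prop) :
  (forall x y, A x -> A y -> x = y) -> finite A.
Proof.
move=> eqA; case: (classic (exists x, A x)) => [[x Ax]|nA].
  by exists [:: x] => y Ay; rewrite inE (eqA _ _ Ay Ax).
by exists [::] => x Ax; case: nA; exists x.
Qed.

Lemma finite_words n : finite (fun w : seq bool => size w <= n).
Proof.
elim: n => [|n [s IH]]; first by exists [:: [::]]; case.
exists ([::] :: [seq true :: w | w <- s] ++ [seq false :: w | w <- s]).
by case=> [|[] w] //= /IH ws; rewrite inE mem_cat map_f ?orbT.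
Qed.

Lemma finite_ltn n : finite (fun i => i < n).
Proof. by exists (iota 0 n) => i; rewrite mem_iota. Qed.

(** All elements of the antichain but one given [f p0 k0] have a coordinate
    smaller than [p0] or [k0], and a row or a column of the grid is a chain,
    which meets the antichain at most once. *)
Lemma antichain_grid_finite (T : eqType) (le : T -> T -> Prop) (A : T -> Prop)
    (f : nat -> nat -> T) : antichain le A ->
    (forall p p' k k', A (f p k) -> p <= p' -> k <= k' -> le (f p k) (f p' k')) ->
  finite (fun x => A x /\ exists p k, x = f p k).
Proof.
move=> anti mono.
have comparable p p' k k' : A (f p k) -> A (f p' k') ->
    p <= p' -> k <= k' -> f p k = f p' k'.
  move=> A1 A2 le_p le_k; apply: NNPP => neq.
  exact: (anti _ _ A1 A2 neq) (mono _ _ _ _ A1 le_p le_k).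
case: (classic (exists p k, A (f p k))) => [[p0 [k0 A0]]|nA]; last first.
  by exists [::] => x [Ax [p [k def_x]]]; case: nA; exists p, k; rewrite -def_x.
have fin_row p : finite (fun x => A x /\ exists k, x = f p k).
  apply: finite_subsingleton => x y [A1 [k eq_x]] [A2 [k' eq_y]]; subst x y.
  by case/orP: (leq_total k k') => le_k; [|apply: esym]; apply: comparable.
have fin_col k : finite (fun x => A x /\ exists p, x = f p k).
  apply: finite_subsingleton => x y [A1 [p eq_x]] [A2 [p' eq_y]]; subst x y.
  by case/orP: (leq_total p p') => le_p; [|apply: esym]; apply: comparable.
have fin0 : finite (fun x => x = f p0 k0) by apply: finite_subsingleton => x y -> ->.
apply: sub_finite (finite_or fin0 (finite_or
  (finite_exists (finite_ltn p0) (fun p _ => fin_row p))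
  (finite_exists (finite_ltn k0) (fun k _ => fin_col k)))).
move=> x [Ax [p [k eq_x]]]; subst x.
case: (ltnP p p0) => [lt_p | le_p].
  by right; left; exists p => //; split=> //; exists k.
case: (ltnP k k0) => [lt_k | le_k].
  by right; right; exists k => //; split=> //; exists p.
by left; rewrite (comparable p0 p k0 k).
Qed.

Lemma consecutive_le_biperiodic ls ms rs p p' k k' :
    0 < p + size ms + k -> p <= p' -> k <= k' ->
  consecutive_le (arrange (p + size ms + k) (biperiodic ls ms rs p))
                 (arrange (p' + size ms + k') (biperiodic ls ms rs p')).
Proof.
move=> n0 le_p le_k.
rewrite (@eq_arrange _ _ (fun x => biperiodic ls ms rs p' (p' - p + x))).
  by apply: consecutive_le_factor => //; lia.
move=> x lt_x; rewrite /biperiodic.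
have -> : (p' - p + x <= p') = (x <= p) by lia.
have -> : (p' - p + x <= p' + size ms) = (x <= p + size ms) by lia.
case: leqP => _; [|case: leqP => _]; congr (nth _ _ _).
- by congr (_ %% _); lia.
- by lia.
- by congr (_ %% _); lia.
Qed.

Lemma consecutive_le_size s r : is_perm s -> is_perm r -> consecutive_le s r ->
  s <> r -> size s < size r.
Proof.
move=> ps pr [k [k0 le_r iso]] neq; rewrite ltn_neqAle; apply/andP; split; last by lia.
apply/eqP => eq_size; apply: neq.
rewrite -(standardize_perm ps) -(standardize_perm pr) iso.
congr standardize; apply/all_filterP/allP => x; have /andP[_ perm_r] := pr.
by rewrite (perm_mem perm_r) mem_iota; lia.
Qed.

Lemma no_infinite_descending B :
  ~ (exists f, (forall i, Av B (f i)) /\ infinite_descending consecutive_le f).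
Proof.
move=> [f [Avf desc]].
have perm_f i : is_perm (f i) by case: (Avf i) => /andP[].
have bound i : size (f i) + i <= size (f 0).
  elim: i => [|i IH]; first by rewrite addn0.
  have [le_f neq_f] := desc i.
  have := consecutive_le_size (perm_f _) (perm_f _) le_f neq_f; lia.
by have := bound (size (f 0)).+1; lia.
Qed.

(** Bounded words [ls], [ms], [rs] split [Av B] into finitely many images of
    grids. *)
Lemma no_flipped_wqo B N : all double_ascent B -> (forall s, s \in B -> size s <= N) ->
    no_flipped_word B N ->
  wqo consecutive_le (Av B).
Proof.
move=> daB sizeB noflip; split; last exact: no_infinite_descending.
have permB : bounded_perms B N.
  by move=> s sB; split; [case/andP: (allP daB s sB) | exact: sizeB].
move=> [A [AvA infA anti]]; apply: infA.
pose X := (2 ^ N + N).+1.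
pose f ls ms rs p k := arrange (p + size ms + k) (biperiodic ls ms rs p).
have fin_f ls ms rs : finite (fun x => A x /\ exists p k, x = f ls ms rs p k).
  apply: antichain_grid_finite anti _ => p p' k k' /AvA[/andP[/andP[n0 _] _] _] le_p le_k.
  by apply: consecutive_le_biperiodic => //; rewrite size_arrange in n0.
have words := finite_words X.
apply: sub_finite (finite_exists words (fun ls _ => finite_exists words (fun ms _ =>
  finite_exists words (fun rs _ => fin_f ls ms rs)))).
move=> x Ax; have [da_x _] := AvA x Ax; have [u def_x] := double_ascentE da_x.
have x0 : 0 < size x by case/andP: da_x => /andP[].
have /(Av_arrange u daB x0) av : Av B (arrange (size x) u) by rewrite -def_x; apply: AvA.
have [ls [ms [rs [p [k [le_ls le_ms le_rs eq_n eq_u]]]]]] :=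
  avoids_biperiodic permB noflip av.
exists ls => //; exists ms => //; exists rs => //; split=> //; exists p, k.
by rewrite def_x (eq_arrange eq_u) eq_n.
Qed.

(** * A calculus of computable functions *)

(** Fixing the number of arguments lets a program copy its whole argument list
    when it calls another one; as lists, the arguments serve as an environment
    of de Bruijn variables for the bounded operators below. *)
Definition computable (k : nat) (f : seq nat -> nat) : Prop :=
  exists p, forall xs, size xs = k -> eval p xs (f xs).

Definition decides (k : nat) (P : seq nat -> bool) : Prop :=
  computable k (fun xs => P xs).

Local Notation "xs .[ i ]" := (nth 0 xs i)
  (at level 1, left associativity, format "xs .[ i ]").

Lemma computable_ext k f g : (forall xs, size xs = k -> f xs = g xs) ->
  computable k f -> computable k g.
Proof. by move=> eq_fg [p ev]; exists p => xs szk; rewrite -eq_fg //; apply: ev. Qed.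

Lemma decides_ext k P Q : (forall xs, size xs = k -> P xs = Q xs) ->
  decides k P -> decides k Q.
Proof. by move=> eqPQ; apply: computable_ext => xs /eqPQ->. Qed.

Fixpoint all_computable (k : nat) (fs : seq (seq nat -> nat)) : Prop :=
  if fs is f :: fs' then computable k f /\ all_computable k fs' else True.

Lemma computable_comp k f fs : computable (size fs) f -> all_computable k fs ->
  computable k (fun xs => f [seq g xs | g <- fs]).
Proof.
move=> [p ev_p] comp_fs.
suff [ps [size_ps ev_ps]] : exists ps, size ps = size fs /\
    forall xs, size xs = k -> forall i, i < size ps ->
      eval (nth Zero ps i) xs (nth 0 [seq g xs | g <- fs] i).
  exists (Comp p ps) => xs szk; apply: eval_Comp (ev_ps xs szk) _.
    by rewrite size_map size_ps.
  by apply: ev_p; rewrite size_map.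
elim: fs comp_fs {ev_p} => [_|g fs IH [[pg ev_g] /IH[ps [size_ps ev_ps]]]].
  by exists [::].
exists (pg :: ps); rewrite /= size_ps; split=> // xs szk [_ | i lt_i].
  exact: ev_g.
by apply: ev_ps; rewrite ?size_ps.
Qed.

Lemma computable_nth k i : computable k (fun xs => xs.[i]).
Proof. by exists (Proj i) => xs _; apply: eval_Proj. Qed.

Lemma computable_succ k f : computable k f -> computable k (fun xs => (f xs).+1).
Proof.
move=> comp_f.
apply: (computable_comp (f := fun xs => xs.[0].+1) (fs := [:: f]) _ (conj comp_f I)).
by exists Succ => xs _; apply: eval_Succ.
Qed.

Lemma computable_const k n : computable k (fun=> n).
Proof.
elim: n => [|n]; last exact: computable_succ.
by exists Zero => xs _; apply: eval_Zero.
Qed.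

Lemma all_computable_nth k js : all_computable k [seq nth 0 ^~ j | j <- js].
Proof. by elim: js => //= j js IH; split; [exact: computable_nth | exact: IH]. Qed.

Lemma computable_select k f js : computable (size js) f ->
  computable k (fun xs => f [seq xs.[j] | j <- js]).
Proof.
move=> comp_f; apply: (computable_ext (f := fun xs =>
    f [seq g xs | g <- [seq nth 0 ^~ j | j <- js]])) => [xs _|].
  by rewrite -map_comp.
by apply: computable_comp; [rewrite size_map | exact: all_computable_nth].
Qed.

Lemma map_nth_iota_drop (xs : seq nat) j k : size xs = j + k ->
  [seq xs.[i] | i <- iota j k] = drop j xs.
Proof.
move=> szk; apply: (@eq_from_nth _ 0);
  rewrite size_map size_iota ?size_drop ?szk ?addKn //.
by move=> i lt_i; rewrite (nth_map 0) ?size_iota // nth_iota // nth_drop.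
Qed.

Lemma computable_drop k j f :
  computable k f -> computable (j + k) (fun xs => f (drop j xs)).
Proof.
move=> comp_f; have := @computable_select (j + k) f (iota j k).
rewrite size_iota => /(_ comp_f); apply: computable_ext => xs szk.
by rewrite map_nth_iota_drop.
Qed.

(** Primitive recursion on the value of [n]: the recursion variable and the
    accumulator are pushed in front of the environment. *)
Lemma computable_iteri k n f x :
    computable k n -> computable k.+2 f -> computable k x ->
  computable k (fun xs => iteri (n xs) (fun i y => f [:: i, y & xs]) (x xs)).
Proof.
move=> comp_n [pf ev_f] [px ev_x].
have rec : computable k.+1 (fun xs =>
    iteri (head 0 xs) (fun i y => f [:: i, y & behead xs]) (x (behead xs))).
  exists (PrimRec px pf) => [[//|m xs] [szk]] /=.
  elim: m => [|m IH] /=; first by apply: eval_PrimRec0; apply: ev_x.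
  by apply: eval_PrimRecS IH _; apply: ev_f; rewrite /= szk.
pose vars := [seq nth 0 ^~ i | i <- iota 0 k].
have sz_vars : size (n :: vars) = k.+1 by rewrite /= size_map size_iota.
rewrite -sz_vars in rec.
have := computable_comp rec (conj comp_n (all_computable_nth k (iota 0 k))).
apply: computable_ext => xs szk /=.
by rewrite -map_comp map_nth_iota_drop // drop0.
Qed.

Lemma computable_iter k n f x :
    computable k n -> computable k.+1 f -> computable k x ->
  computable k (fun xs => iter (n xs) (fun y => f (y :: xs)) (x xs)).
Proof.
move=> comp_n /(computable_drop 1) comp_f comp_x.
apply: (computable_ext _ (computable_iteri comp_n comp_f comp_x)) => xs _.
by elim: (n xs) => //= m ->; rewrite drop0.
Qed.

Lemma computable_app1 k h f : computable 1 (fun xs => h xs.[0]) ->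
  computable k f -> computable k (fun xs => h (f xs)).
Proof.
move=> comp_h comp_f.
exact: (computable_comp comp_h (fs := [:: f]) (conj comp_f I)).
Qed.

Lemma computable_app2 k h f g : computable 2 (fun xs => h xs.[0] xs.[1]) ->
  computable k f -> computable k g -> computable k (fun xs => h (f xs) (g xs)).
Proof.
move=> comp_h comp_f comp_g.
exact: (computable_comp comp_h (fs := [:: f; g]) (conj comp_f (conj comp_g I))).
Qed.

Lemma computable_if k P f g : decides k P -> computable k f -> computable k g ->
  computable k (fun xs => if P xs then f xs else g xs).
Proof.
move=> decP /(computable_drop 2) comp_f comp_g.
apply: (computable_ext _ (computable_iteri decP comp_f comp_g)) => xs _.
by case: (P xs) => //=; rewrite drop0.
Qed.

Lemma decides_const k b : decides k (fun=> b).
Proof. exact: computable_const. Qed.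

Lemma decides_if k P Q R : decides k P -> decides k Q -> decides k R ->
  decides k (fun xs => if P xs then Q xs else R xs).
Proof.
move=> decP decQ decR; apply: computable_ext (computable_if decP decQ decR) => xs _.
by case: ifP.
Qed.

Lemma decides_not k P : decides k P -> decides k (fun xs => ~~ P xs).
Proof.
move=> decP.
exact: (decides_if decP (decides_const k false) (decides_const k true)).
Qed.

Lemma decides_and k P Q : decides k P -> decides k Q -> decides k (fun xs => P xs && Q xs).
Proof. by move=> decP decQ; exact: (decides_if decP decQ (decides_const k false)). Qed.

Lemma decides_or k P Q : decides k P -> decides k Q -> decides k (fun xs => P xs || Q xs).
Proof. by move=> decP decQ; exact: (decides_if decP (decides_const k true) decQ). Qed.

Lemma decides_xor k P Q : decides k P -> decides k Q -> decides k (fun xs => P xs (+) Q xs).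
Proof. move=> decP decQ; apply: decides_ext (decides_if decP (decides_not decQ) decQ) => xs _.
by case: (P xs). Qed.

Lemma decides_eqb k P Q : decides k P -> decides k Q -> decides k (fun xs => P xs == Q xs).
Proof.
move=> decP decQ; apply: decides_ext (decides_if decP decQ (decides_not decQ)) => xs _.
by case: (P xs) (Q xs) => [] [].
Qed.

Lemma computable_pred k f : computable k f -> computable k (fun xs => (f xs).-1).
Proof.
move=> comp_f.
apply: (computable_ext _ (computable_iteri comp_f (computable_nth _ 0) (computable_const k 0))).
by move=> xs _; case: (f xs).
Qed.

Lemma computable_add k f g : computable k f -> computable k g ->
  computable k (fun xs => f xs + g xs).
Proof.
move=> comp_f comp_g.
apply: (computable_ext _ (computable_iter comp_g (computable_succ (computable_nth _ 0)) comp_f)).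
by move=> xs _ /=; elim: (g xs) => [|n /= ->]; rewrite ?addn0 ?addnS.
Qed.

Lemma computable_sub k f g : computable k f -> computable k g ->
  computable k (fun xs => f xs - g xs).
Proof.
move=> comp_f comp_g.
apply: (computable_ext _ (computable_iter comp_g (computable_pred (computable_nth _ 0)) comp_f)).
by move=> xs _ /=; elim: (g xs) => [|n /= ->]; rewrite ?subn0 ?subnS.
Qed.

Lemma computable_mul k f g : computable k f -> computable k g ->
  computable k (fun xs => f xs * g xs).
Proof.
apply: computable_app2.
apply: (computable_ext _ (computable_iter (f := fun ys => ys.[0] + ys.[1])
  (computable_nth _ 1) _ (computable_const 2 0))).
  by move=> xs _ /=; elim: (xs.[1]) => [|n /= ->]; rewrite ?muln0 ?mulnSr.
by apply: computable_add; apply: computable_nth.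
Qed.

Lemma decides_leq k f g : computable k f -> computable k g ->
  decides k (fun xs => f xs <= g xs).
Proof.
move=> comp_f comp_g.
apply: (computable_ext _ (computable_iter (computable_sub comp_f comp_g)
  (computable_const _ 0) (computable_const k 1))).
by move=> xs _ /=; rewrite -subn_eq0; case: (_ - _).
Qed.

Lemma decides_eq k f g : computable k f -> computable k g ->
  decides k (fun xs => f xs == g xs).
Proof.
move=> comp_f comp_g.
apply: decides_ext (decides_and (decides_leq comp_f comp_g) (decides_leq comp_g comp_f)).
by move=> xs _; rewrite eqn_leq.
Qed.

Create HintDb computable.
#[local] Hint Resolve computable_nth computable_succ computable_const computable_if decides_const
  decides_if decides_not decides_and decides_or decides_xor decides_eqb computable_pred
  computable_add computable_sub computable_mul decides_leq decides_eq : computable.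

Lemma computable_modn k f g : computable k f -> computable k g ->
  computable k (fun xs => f xs %% g xs).
Proof.
apply: computable_app2.
apply: (computable_ext _ (computable_iter
  (f := fun ys => if ys.[0].+1 == ys.[2] then 0 else ys.[0].+1)
  (computable_nth _ 0) _ (computable_const 2 0))); last by auto with computable.
move=> xs _ /=; move: (xs.[0]) (xs.[1]) => m d.
elim: m => [|m /= ->]; first by rewrite mod0n.
rewrite modnS; suff -> : ((m %% d).+1 == d) = (d %| m.+1) by [].
case: (posnP d) => [-> | d0]; first by rewrite dvd0n.
rewrite /dvdn -(addn1 m) -modnDml addn1; have := ltn_pmod m d0; rewrite leq_eqVlt.
by case/predU1P=> [-> | lt_d]; [rewrite modnn eqxx | rewrite (modn_small lt_d) ltn_eqF].
Qed.

Lemma computable_exp2 k f : computable k f -> computable k (fun xs => 2 ^ f xs).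
Proof.
move=> comp_f.
apply: (computable_ext _ (computable_iter (f := fun ys => ys.[0] + ys.[0])
  comp_f _ (computable_const k 1))); last by auto with computable.
by move=> xs _ /=; elim: (f xs) => //= n ->; rewrite expnS mul2n addnn.
Qed.

Lemma decides_odd k f : computable k f -> decides k (fun xs => odd (f xs)).
Proof.
move=> comp_f.
apply: (computable_ext _ (computable_iter (f := fun ys => if ys.[0] == 0 then 1 else 0)
  comp_f _ (computable_const k 0))); last by auto with computable.
by move=> xs _ /=; elim: (f xs) => //= n ->; case: (odd n).
Qed.

Lemma computable_half k f : computable k f -> computable k (fun xs => (f xs)./2).
Proof.
move=> comp_f.
apply: (computable_ext _ (computable_iteri (f := fun ys => ys.[0] - ys.[1])
  comp_f _ (computable_const k 0))); last by auto with computable.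
by move=> xs _ /=; elim: (f xs) => //= n ->; lia.
Qed.

(** Numbers below [2 ^ q] stand for the patterns of length [q]. *)
Definition bit (c i : nat) : bool := odd (iter i half c).

Lemma decides_bit k f g : computable k f -> computable k g ->
  decides k (fun xs => bit (f xs) (g xs)).
Proof.
move=> comp_f comp_g; apply: decides_odd.
apply: (computable_iter (f := fun ys => ys.[0]./2) comp_g _ comp_f).
exact/computable_half/computable_nth.
Qed.

#[local] Hint Resolve computable_modn computable_exp2 decides_odd computable_half decides_bit : computable.

(** Bounded search from below: a position that has been found, being smaller
    than the current bound, is kept. *)
Lemma computable_find k n P : computable k n -> decides k.+1 P ->
  computable k (fun xs => find (fun i => P (i :: xs)) (iota 0 (n xs))).
Proof.
move=> comp_n decP.
have decP' : decides k.+2 (fun ys => P (ys.[0] :: drop 2 ys)).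
  have := @computable_select k.+2 P (0 :: iota 2 k).
  rewrite /= size_iota => /(_ decP); apply: computable_ext => xs szk.
  by rewrite /= map_nth_iota_drop.
apply: (computable_ext _ (computable_iteri
  (f := fun ys => if ys.[1] < ys.[0] then ys.[1]
                  else if P (ys.[0] :: drop 2 ys) then ys.[0] else ys.[0].+1)
  comp_n _ (computable_const k 0))); last by auto 6 with computable.
move=> xs _ /=; rewrite drop0; elim: (n xs) => // m IH.
rewrite -addn1 iotaD find_cat /= size_iota addn1 /= IH.
rewrite -[X in _ < X](size_iota 0 m) -has_find; case: has => //.
by case: (P _); lia.
Qed.

Lemma decides_has k n P : computable k n -> decides k.+1 P ->
  decides k (fun xs => has (fun i => P (i :: xs)) (iota 0 (n xs))).
Proof.
move=> comp_n decP; have comp_find := computable_find comp_n decP.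
apply: decides_ext (decides_leq (computable_succ comp_find) comp_n).
by move=> xs _; rewrite has_find size_iota.
Qed.

Lemma decides_all k n P : computable k n -> decides k.+1 P ->
  decides k (fun xs => all (fun i => P (i :: xs)) (iota 0 (n xs))).
Proof.
move=> comp_n decP.
apply: decides_ext (decides_not (decides_has comp_n (decides_not decP))).
by move=> xs _; rewrite -all_predC; apply: eq_all => i /=; rewrite negbK.
Qed.

(** * Reading the code of a basis *)

(** A list with head [n] and a tail of code [m] has code [2 ^ n * m.*2.+1], which
    ends in exactly [n] zero bits. *)
Definition code_head (c : nat) : nat := find (bit c) (iota 0 c).
Definition code_tail (c : nat) : nat := iter (code_head c).+1 half c.
(** The empty list has code [0], whose head and tail are [0]; so an entry past
    the end of a list is [0], as with [nth 0]. *)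
Definition entry (c i : nat) : nat := code_head (iter i code_tail c).

Lemma iter_half_exp2 n m : iter n half (2 ^ n * m) = m.
Proof. by elim: n => [|n IH]; rewrite ?mul1n // iterSr expnS -mulnA mul2n doubleK. Qed.

Lemma find_iota (P : pred nat) n b : n < b -> P n -> (forall i, i < n -> ~~ P i) ->
  find P (iota 0 b) = n.
Proof.
move=> lt_n Pn Pltn; rewrite -(subnKC lt_n) -addn1 -addnA iotaD find_cat.
case: ifP => [/hasP[i] | _]; first by rewrite mem_iota => /Pltn/negPf->.
by rewrite size_iota /= Pn addn0.
Qed.

Lemma code_head_cons n s : code_head (CodeSeq.code (n :: s)) = n.
Proof.
rewrite /code_head /=; set m := (CodeSeq.code s).*2.+1; apply: find_iota.
- by rewrite (leq_trans (ltn_expl n (isT : 1 < 2))) // leq_pmulr.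
- by rewrite /bit iter_half_exp2 /= odd_double.
- move=> i lt_i; rewrite /bit -(subnKC (ltnW lt_i)) expnD -mulnA iter_half_exp2.
  by rewrite oddM oddX orbF subn_eq0 leqNgt lt_i.
Qed.

Lemma code_tail_cons n s : code_tail (CodeSeq.code (n :: s)) = CodeSeq.code s.
Proof.
by rewrite /code_tail code_head_cons iterS iter_half_exp2 /= uphalf_double.
Qed.

Lemma entry_code s i : entry (CodeSeq.code s) i = nth 0 s i.
Proof.
rewrite /entry; elim: s i => [|n s IH] [|i] //.
- by rewrite nth_nil; have -> : iter i.+1 code_tail 0 = 0 by elim: i => //= i ->.
- by rewrite /= code_head_cons.
- by rewrite iterSr code_tail_cons IH.
Qed.

Lemma size_code s : size s <= CodeSeq.code s.
Proof.
elim: s => //= n s IH; have : 0 < 2 ^ n by rewrite expn_gt0.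
by move: (2 ^ n) (CodeSeq.code s) IH => a b; nia.
Qed.

Lemma bits_exist (f : nat -> bool) n :
  exists2 c, c < 2 ^ n & forall i, i < n -> bit c i = f i.
Proof.
elim: n f => [|n IH] f; first by exists 0.
have [c lt_c bit_c] := IH (f \o succn); exists (f 0 + c.*2).
  by rewrite expnS; case: (f 0); lia.
case=> [_ | i lt_i]; first by rewrite /bit /= oddD odd_double addbF oddb.
by rewrite /bit iterSr half_bit_double; apply: bit_c.
Qed.

(** * The decision procedure *)

(** Entries of a permutation are positive, so [entry s i = 0] marks the end of
    the list, and the code [0], read past the end of the basis, never occurs.
    The largest entry of a permutation is its length, so bounding all entries
    keeps the occurrence inside the word. *)
Definition occurs_at (m c q L s o : nat) : bool :=
  (0 < entry s 0) &&
  all (fun i => (o + entry s i <= L) && ((entry s i.+1 == 0) ||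
         before (fun x => flipped (bit c) q L (o + x)) (entry s i) (entry s i.+1)))
      (iota 0 m).

Definition excludes (m c q L : nat) : bool :=
  ~~ has (fun j => has (fun o => occurs_at m c q L (entry m j) o) (iota 0 L)) (iota 0 m).

Definition flip_exists (m : nat) : bool :=
  has (fun q => has (fun r => has (fun c => excludes m c q (q * (m + 4) + r))
    (iota 0 (2 ^ q))) (iota 0 q)) (iota 0 (2 ^ m).+1).

Lemma occurs_atP m c q L s : is_perm s -> size s <= m ->
  reflect (occurs s L (flipped (bit c) q L))
    (has (fun o => occurs_at m c q L (CodeSeq.code s) o) (iota 0 L)).
Proof.
move=> perm_s le_m; have /andP[s0 ps] := perm_s.
have bounds := allP (perm_iota_bounds ps).
have bound_nth i : i < size s -> 0 < nth 0 s i <= size s.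
  by move=> lt_i; apply/bounds/mem_nth.
apply: (iffP hasP) => [[o _ /andP[_ /allP all_o]] | [o le_o sort_s]].
  have {}all_o i : i < size s -> o + nth 0 s i <= L /\ (i.+1 < size s ->
      before (fun x => flipped (bit c) q L (o + x)) (nth 0 s i) (nth 0 s i.+1)).
    move=> lt_i; have := all_o i.
    rewrite mem_iota !entry_code => /(_ _)/andP[|-> bef]; first by lia.
    split=> // lt_i1; case/orP: bef => // /eqP eq0.
    by have := bound_nth _ lt_i1; rewrite eq0.
  exists o.
    have size_in : size s \in s by rewrite (perm_mem ps) mem_iota; lia.
    by have [] := all_o (index (size s) s); rewrite ?index_mem // nth_index.
  by apply/(sortedP 0) => i lt_i; apply: (proj2 (all_o i _)); rewrite // ltnW.
exists o; first by rewrite mem_iota; lia.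
rewrite /occurs_at entry_code; have /andP[-> _] := bound_nth 0 s0.
apply/allP => i _; rewrite !entry_code.
case: (ltnP i (size s)) => [lt_i|ge_i]; last first.
  by rewrite !nth_default ?addn0 ?eqxx ?andbT; lia.
have := bound_nth i lt_i => /andP[_ le_nth]; apply/andP; split; first by lia.
case: (ltnP i.+1 (size s)) => [lt_i1|ge_i]; last by rewrite (nth_default 0 ge_i).
by rewrite (sortedP 0 sort_s) ?orbT.
Qed.

Lemma size_basis B s : s \in B -> size s <= code_basis B.
Proof.
move=> sB; apply: leq_trans (size_code s) (ltnW _).
exact: (allP (CodeSeq.ltn_code _)) (map_f _ sB).
Qed.

Lemma excludesP B c q L : all double_ascent B ->
  reflect (avoids B L (flipped (bit c) q L)) (excludes (code_basis B) c q L).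
Proof.
move=> /allP daB; rewrite /excludes; set m := code_basis B.
have entry_m j : entry m j = CodeSeq.code (nth [::] B j).
  rewrite /m /code_basis entry_code; case: (ltnP j (size B)) => [lt_j|ge_j].
    by rewrite (nth_map [::]).
  by rewrite !nth_default // size_map.
have sizeB : size B <= m.
  by rewrite -(size_map CodeSeq.code B); apply: size_code.
have size_s := @size_basis B.
have perm_s s : s \in B -> is_perm s by case/daB/andP.
apply: (iffP idP) => [/hasPn no_occ s sB occ|av].
  move/(occurs_atP c q L (perm_s s sB) (size_s s sB)): occ => occ.
  have := no_occ (index s B); rewrite mem_iota entry_m nth_index // occ => /(_ _).
  move=> no; suff: ~~ true by [].
  by apply: no; rewrite /= add0n (leq_trans _ sizeB) // index_mem.
apply/hasPn => j _; rewrite entry_m; case: (ltnP j (size B)) => [lt_j|ge_j].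
  have sB := mem_nth [::] lt_j.
  by apply/negP => /(occurs_atP c q L (perm_s _ sB) (size_s _ sB)); apply: av.
by rewrite nth_default //; apply/hasPn => o _; rewrite /occurs_at entry_code.
Qed.

(** The code of [B] bounds the lengths of its elements, so it can play the role
    of [N]; only the [q] letters [f 0], ..., [f q.-1] of a pattern matter, and
    they are the bits of a number below [2 ^ q]. *)
Lemma flip_existsP B : all double_ascent B ->
  flip_exists (code_basis B) <-> ~ wqo consecutive_le (Av B).
Proof.
move=> daB; set m := code_basis B.
have size_s := @size_basis B; rewrite -/m in size_s.
split=> [/hasP[q _ /hasP[r]] | not_wqo].
  rewrite mem_iota => lt_r /hasP[c _ /(excludesP c q _ daB) av].
  by apply: flipped_not_wqo daB size_s _ av; lia.
apply/negPn/negP => /hasPn none; apply: not_wqo.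
apply: (no_flipped_wqo daB size_s) => q r f lt_q lt_r av.
have [c lt_c bit_c] := bits_exist f q.
have /none/hasPn/(_ r) : q \in iota 0 (2 ^ m).+1 by rewrite mem_iota; lia.
rewrite mem_iota => /(_ lt_r)/hasPn/(_ c); rewrite mem_iota => /(_ lt_c)/negP; apply.
apply/(excludesP c q _ daB) => s sB occ; apply: (av s sB).
have /andP[perm_s _] := allP daB s sB.
apply: eq_occurs perm_s _ occ => x _.
by rewrite /flipped bit_c // ltn_pmod; lia.
Qed.

Lemma computable_entry k f g : computable k f -> computable k g ->
  computable k (fun xs => entry (f xs) (g xs)).
Proof.
have comp_head k' h : computable k' h -> computable k' (fun xs => code_head (h xs)).
  apply: computable_app1.
  by apply: (computable_find (P := fun ys => bit ys.[1] ys.[0]));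
    auto with computable.
have comp_tail k' h : computable k' h -> computable k' (fun xs => code_tail (h xs)).
  apply: computable_app1.
  by apply: (computable_iter (f := fun ys => ys.[0]./2)); auto with computable.
apply: computable_app2; apply: comp_head.
by apply: (computable_iter (f := fun ys => code_tail ys.[0])); auto with computable.
Qed.

Lemma decides_occurs_at k f0 f1 f2 f3 f4 f5 :
    computable k f0 -> computable k f1 -> computable k f2 ->
    computable k f3 -> computable k f4 -> computable k f5 ->
  decides k (fun xs => occurs_at (f0 xs) (f1 xs) (f2 xs) (f3 xs) (f4 xs) (f5 xs)).
Proof.
move=> h0 h1 h2 h3 h4 h5.
suff base : decides 6 (fun xs => occurs_at xs.[0] xs.[1] xs.[2] xs.[3] xs.[4] xs.[5]).
  exact: (computable_comp base (fs := [:: f0; f1; f2; f3; f4; f5])).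
apply: decides_and; first by auto using computable_entry with computable.
apply: (decides_all (P := fun ys => (ys.[6] + entry ys.[5] ys.[0] <= ys.[4]) &&
  ((entry ys.[5] ys.[0].+1 == 0) ||
   before (fun x => flipped (bit ys.[2]) ys.[3] ys.[4] (ys.[6] + x))
     (entry ys.[5] ys.[0]) (entry ys.[5] ys.[0].+1)))); first exact: computable_nth.
rewrite /before /flipped.
auto 20 using computable_entry with computable.
Qed.

Theorem corollary12p5 :
  algorithmically_decidable code_basis
    (fun B : seq (seq nat) => all double_ascent B)
    (fun B : seq (seq nat) => wqo consecutive_le (Av B)).
Proof.
have dec_excludes : decides 4 (fun xs => excludes xs.[0] xs.[1] xs.[2] xs.[3]).
  apply: decides_not; apply: (decides_has (P := fun ys => has (fun o =>
    occurs_at ys.[1] ys.[2] ys.[3] ys.[4] (entry ys.[1] ys.[0]) o) (iota 0 ys.[4]))).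
    exact: computable_nth.
  apply: (decides_has (P := fun ys =>
    occurs_at ys.[2] ys.[3] ys.[4] ys.[5] (entry ys.[2] ys.[1]) ys.[0])).
    exact: computable_nth.
  by apply: decides_occurs_at; auto using computable_entry with computable.
have [p ev_p] : decides 1 (fun xs => ~~ flip_exists xs.[0]).
  apply: decides_not; apply: (decides_has (P := fun ys => has (fun r => has (fun c =>
    excludes ys.[1] c ys.[0] (ys.[0] * (ys.[1] + 4) + r))
    (iota 0 (2 ^ ys.[0]))) (iota 0 ys.[0]))).
    by auto with computable.
  apply: (decides_has (P := fun ys => has (fun c =>
    excludes ys.[2] c ys.[1] (ys.[1] * (ys.[2] + 4) + ys.[0])) (iota 0 (2 ^ ys.[1])))).
    by auto with computable.
  apply: (decides_has (P := fun ys =>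
    excludes ys.[3] ys.[0] ys.[2] (ys.[2] * (ys.[3] + 4) + ys.[1]))).
    by auto with computable.
  apply: (computable_comp dec_excludes (fs := [:: nth 0 ^~ 3; nth 0 ^~ 0; nth 0 ^~ 2;
    fun ys => ys.[2] * (ys.[3] + 4) + ys.[1]])).
  by do !split; auto with computable.
exists p => B daB; exists (~~ flip_exists (code_basis B)); split.
  exact: (ev_p [:: code_basis B]).
split=> [/negP no_flip | is_wqo]; first by apply: NNPP => /(flip_existsP daB).
by apply/negP => /(flip_existsP daB).
Qed.
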